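(* For even $n$, let $\mathrm{EQ}'_n$ be the partial two-party function defined on pairs $(x,y)\in\{0,1\}^n\times\{0,1\}^n$ by $$\mathrm{EQ}'_n(x,y)=\begin{cases}1 & \text{if } H(x,y)\in\{0,1,n-1,n\},\\ 0 & \text{if } H(x,y)=\tfrac{n}{2},\end{cases}$$ and undefined otherwise, where $H(x,y)$ is the Hamming distance. Then the exact quantum communication complexity satisfies $Q_E(\mathrm{EQ}'_n)\in \mathbf{O}(\log n)$.
   Context: Two-party communication model: Alice holds $x$, Bob holds $y$; they exchange messages (bits, or qubits in the quantum model) according to a protocol, local computation being free. A protocol computes a partial function $f$ exactly if for every input pair in the domain of $f$ it outputs $f(x,y)$ with probability $1$. The cost of a protocol is the worst-case number of (qu)bits exchanged, and $Q_E(f)$ is the minimum cost of an exact quantum protocol computing $f$. *)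

(* Defs.v *)
From HB Require Import structures.
From mathcomp Require Import all_boot all_order all_algebra.
From mathcomp Require Import complex spectral.
From mathcomp Require Import all_classical all_reals all_analysis.

Set Implicit Arguments.
Unset Strict Implicit.
Unset Printing Implicit Defensive.

Import Order.TTheory GRing.Theory Num.Theory.

Local Open Scope classical_set_scope.
Local Open Scope ring_scope.

(* Quantum communication without prior entanglement.  The w qubits of a       *)
(* protocol (workspaces and messages together) all start in |0>; at any time  *)
(* each of them is held either by Alice or by Bob.                            *)

Definition basis (w : nat) := {ffun 'I_w -> bool}.

(* The coordinate at the basis state |a> is the one of index enum_rank a. *)
Definition qstate (R : realType) (w : nat) := 'cV[R[i]]_#|{: basis w}|.
Definition qop (R : realType) (w : nat) := 'M[R[i]]_#|{: basis w}|.

Definition restrict_basis (w : nat) (S : {set 'I_w}) (a : basis w) : basis w :=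
  [ffun q => (q \in S) && a q].

(* U is V (x) Id, with V acting on the qubits in S and Id on the others. *)
Definition acts_on (R : realType) (w : nat) (S : {set 'I_w}) (U : qop R w) :=
  exists V : basis w -> basis w -> R[i], forall a b : basis w,
    U (enum_rank a) (enum_rank b) =
      if restrict_basis (~: S) a == restrict_basis (~: S) b
      then V (restrict_basis S a) (restrict_basis S b) else 0.

(* [Send q] hands qubit q over from its current holder to the other party; a  *)
(* message of k qubits is k such steps.                                       *)
Inductive step (R : realType) (X Y : Type) (w : nat) : Type :=
| AliceOp of X -> qop R w
| BobOp of Y -> qop R w
| Send of 'I_w.

Arguments AliceOp {R X Y w} _.
Arguments BobOp {R X Y w} _.
Arguments Send {R X Y w} _.

Definition hand_over (w : nat) (q : 'I_w) (A : {set 'I_w}) : {set 'I_w} :=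
  if q \in A then A :\ q else q |: A.

(* A is the set of qubits held by Alice when the steps in s begin. *)
Fixpoint well_formed (R : realType) (X Y : Type) (w : nat) (A : {set 'I_w})
    (s : seq (step R X Y w)) : Prop :=
  match s with
  | [::] => True
  | AliceOp U :: s' =>
      (forall x, U x \is unitarymx /\ acts_on A (U x)) /\ well_formed A s'
  | BobOp U :: s' =>
      (forall y, U y \is unitarymx /\ acts_on (~: A) (U y)) /\ well_formed A s'
  | Send q :: s' => well_formed (hand_over q A) s'
  end.

Record protocol (R : realType) (X Y : Type) := Protocol {
  qubits : nat;
  alice_start : {set 'I_qubits};
  steps : seq (step R X Y qubits);
  output : 'I_qubits;
  steps_wf : well_formed alice_start steps }.

Definition is_send (R : realType) (X Y : Type) (w : nat) (t : step R X Y w) :=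
  if t is Send _ then true else false.

(* The schedule of the steps does not depend on the inputs, so this is the    *)
(* number of qubits exchanged on every input pair.                            *)
Definition cost (R : realType) (X Y : Type) (P : protocol R X Y) : nat :=
  count (@is_send R X Y (qubits P)) (steps P).

Definition apply_step (R : realType) (X Y : Type) (w : nat) (x : X) (y : Y)
    (psi : qstate R w) (t : step R X Y w) : qstate R w :=
  match t with
  | AliceOp U => U x *m psi
  | BobOp U => U y *m psi
  | Send _ => psi
  end.

Definition zero_state (R : realType) (w : nat) : qstate R w :=
  delta_mx (enum_rank ([ffun=> false] : basis w)) ord0.

Definition final_state (R : realType) (X Y : Type) (P : protocol R X Y)
    (x : X) (y : Y) : qstate R (qubits P) :=
  foldl (apply_step x y) (zero_state R (qubits P)) (steps P).

(* Probability that the output qubit, measured in the computational basis     *)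
(* after the last step, yields b.                                             *)
Definition prob_output (R : realType) (X Y : Type) (P : protocol R X Y)
    (x : X) (y : Y) (b : bool) : R[i] :=
  \sum_(a : basis (qubits P) | a (output P) == b)
    `|final_state P x y (enum_rank a) ord0| ^+ 2.

(* A partial function is undefined where it returns None. *)
Definition computes_exactly (R : realType) (X Y : Type) (P : protocol R X Y)
    (f : X -> Y -> option bool) : Prop :=
  forall x y b, f x y = Some b -> prob_output P x y b = 1.

(* Extended-real valued, so that the value would be +oo, and not 0, if no     *)
(* exact protocol existed; otherwise the infimum is a minimum.                *)
Definition Q_E (R : realType) (X Y : Type) (f : X -> Y -> option bool) :
    \bar R :=
  ereal_inf [set ((cost P)%:R)%:E | P in
               [set P : protocol R X Y | computes_exactly P f]].

Definition Hamming (n : nat) (x y : n.-tuple bool) : nat :=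
  #|[set i : 'I_n | tnth x i != tnth y i]%SET|.

(* For even n the two cases are disjoint except when n = 0 or n = 2, which    *)
(* are irrelevant to an asymptotic bound.                                     *)
Definition EQ' (n : nat) (x y : n.-tuple bool) : option bool :=
  if Hamming x y \in [:: 0; 1; n - 1; n]%N then Some true
  else if Hamming x y == (n %/ 2)%N then Some false
  else None.

(* Main.v *)
Require Import Defs.
From mathcomp Require Import all_boot all_order all_algebra.
From mathcomp Require Import complex spectral ring lra zify.
From mathcomp Require Import all_classical all_reals all_analysis.

Set Implicit Arguments.
Unset Strict Implicit.
Unset Printing Implicit Defensive.

Import Order.TTheory GRing.Theory Num.Theory Defs.

Local Open Scope classical_set_scope.
Local Open Scope ring_scope.

(** Give Alice a real unit vector u_x and Bob a real unit vector v_y in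
    dimension O(n) whose overlap a = <u_x, v_y> is 0 when H(x, y) = n/2 and
    +-1/2 when H(x, y) is one of 0, 1, n-1, n.  A vector fits in O(log n)
    qubits, and one round of exact amplitude amplification separates the two
    cases: Alice prepares u_x, Bob reflects about v_y, Alice reflects about u_x,
    which yields -(1 - 4 a^2) u_x - 2 a v_y.  This is +-v_y when a = +-1/2, and
    -u_x, orthogonal to v_y, when a = 0; Bob finishes by testing for v_y.

    The vectors are Deutsch-Jozsa states: sum_i (-1)^(x_i) |i> has overlap
    1 - 2 H(x, y) / n with its analogue for y.  Alice places hers in one of two
    blocks, chosen by the parity of x; Bob weights the two blocks according to
    the parity of x + y, that is, of H(x, y), which tells {0, n} from
    {1, n-1}, and one extra coordinate normalises his vector. *)

(** * Real inner products and reflections *)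

Definition dot (R : realType) (N : nat) (a b : 'cV[R]_N) : R :=
  \sum_i a i 0 * b i 0.

Section Dot.
Variables (R : realType) (N : nat).
Implicit Types a b c : 'cV[R]_N.

Lemma dotE a b : a^T *m b = (dot a b)%:M.
Proof.
apply/matrixP => i j; rewrite !ord1 !mxE eqxx mulr1n.
by apply: eq_bigr => k _; rewrite !mxE.
Qed.

Lemma dotC a b : dot a b = dot b a.
Proof. by apply: eq_bigr => i _; rewrite mulrC. Qed.

Lemma dotDr a b c : dot a (b + c) = dot a b + dot a c.
Proof. by rewrite -big_split; apply: eq_bigr => i _; rewrite mxE mulrDr. Qed.

Lemma dotZr a k b : dot a (k *: b) = k * dot a b.
Proof. by rewrite mulr_sumr; apply: eq_bigr => i _; rewrite mxE mulrCA. Qed.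

Lemma dotBr a b c : dot a (b - c) = dot a b - dot a c.
Proof. by rewrite dotDr -scaleN1r dotZr mulN1r. Qed.

Lemma dotBl a b c : dot (a - b) c = dot a c - dot b c.
Proof. by rewrite dotC dotBr !(dotC c). Qed.

Lemma dot_delta a k : dot a (delta_mx k 0) = a k 0.
Proof.
rewrite /dot (bigD1 k) //= mxE !eqxx mulr1 big1 ?addr0 // => i /negPf ik.
by rewrite mxE ik mulr0.
Qed.

(** The reflection along [r] when [c] is 2 / <r, r>. Keeping [c] separate avoids normalising:
    [c = 2] serves unit vectors, [c = 1] differences of two orthonormal vectors. *)
Definition householder (c : R) (r : 'cV[R]_N) : 'M[R]_N :=
  1%:M - c *: (r *m r^T).

Lemma householder_mul k r a : householder k r *m a = a - (k * dot r a) *: r.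
Proof.
by rewrite mulmxBl mul1mx -scalemxAl -mulmxA dotE mul_mx_scalar scalerA.
Qed.

Lemma householder_orthogonal k r : k * dot r r = 2 ->
  householder k r *m (householder k r)^T = 1%:M.
Proof.
move=> cr2; have -> : (householder k r)^T = householder k r.
  by rewrite linearB /= linearZ /= trmx1 trmx_mul trmxK.
rewrite {2}/householder mulmxBr mulmx1 -scalemxAr mulmxA householder_mul cr2.
rewrite mulmxBl -scalemxAl {1}/householder scalerBr scalerA.
apply/matrixP => i j; rewrite !mxE; ring.
Qed.

End Dot.

(** * Real matrices as quantum operations *)

Definition toC (R : realType) (m n : nat) (A : 'M[R]_(m, n)) :
    'M[R[i]]_(m, n) :=
  map_mx (real_complex R) A.

Lemma unitary_toC (R : realType) (N : nat) (A : 'M[R]_N) :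
  A *m A^T = 1%:M -> toC A \is unitarymx.
Proof.
move=> AA; apply/unitarymxP.
have -> : ((toC A)^t* )%sesqui = toC A^T.
  by apply/matrixP => i j; rewrite !mxE; apply: conjc_real.
by rewrite /toC -map_mxM AA map_mx1.
Qed.

Lemma normC_real_complex (R : realType) (r : R) :
  `|real_complex R r| ^+ 2 = real_complex R (r ^+ 2).
Proof.
by rewrite -add_Re2_Im2 /= expr0n /= addr0.
Qed.

Lemma acts_on_setT (R : realType) (w : nat) (U : qop R w) :
  acts_on [set: 'I_w]%SET U.
Proof.
exists (fun a b => U (enum_rank a) (enum_rank b)) => a b.
have rT c : restrict_basis [set: 'I_w]%SET c = c.
  by apply/ffunP => q; rewrite ffunE finset.in_setT.
rewrite !rT ifT //; apply/eqP/ffunP => q.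
by rewrite !ffunE finset.in_setC finset.in_setT.
Qed.

(** * Handing over the whole register *)

Section Sends.
Variables (R : realType) (X Y : Type) (w : nat).

Definition send_all : seq (step R X Y w) := [seq Send q | q <- enum 'I_w].

Lemma count_send_all : count (@is_send R X Y w) send_all = w.
Proof.
by rewrite count_map (@eq_count _ _ predT) // count_predT size_enum_ord.
Qed.

Lemma foldl_send_all x y (psi : qstate R w) :
  foldl (apply_step x y) psi send_all = psi.
Proof. by rewrite /send_all; elim: (enum _) => //=. Qed.

(** Each [hand_over p] toggles the membership of [p] alone, and [uniq] prevents a second toggle. *)
Lemma in_foldl_hand_over (l : seq 'I_w) (A : {set 'I_w}) q : uniq l ->
  (q \in foldl (fun B p => hand_over p B) A l) = (q \in A) (+) (q \in l).
Proof.
elim: l A => [|p l IH] A /=; first by rewrite addbF.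
case/andP=> pl ul; rewrite IH // in_cons /hand_over.
have [->|qp] := eqVneq q p; last first.
  by case: ifP => _; rewrite !inE (negPf qp).
by rewrite (negPf pl); case: ifP => pA; rewrite !inE eqxx // pA.
Qed.

Lemma well_formed_send_all (A : {set 'I_w}) (s : seq (step R X Y w)) :
  well_formed A (send_all ++ s) <-> well_formed (~: A)%SET s.
Proof.
have -> : (~: A)%SET = foldl (fun B p => hand_over p B) A (enum 'I_w).
  apply/setP => q; rewrite in_foldl_hand_over ?enum_uniq // mem_enum !inE.
  by rewrite addbT.
by rewrite /send_all; elim: (enum _) A => //=.
Qed.

End Sends.

(** * Coordinates as basis states of a register *)

Lemma injection_into (T T' : finType) (P : pred T') (x0 : T') :
  (#|T| <= #|P|)%N -> exists2 f : T -> T', injective f & forall t, P (f t).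
Proof.
move=> TP.
have szP (t : T) : (enum_rank t < size (enum P))%N.
  by rewrite -cardE (leq_trans _ TP) // ltn_ord.
exists (fun t => nth x0 (enum P) (enum_rank t)).
  move=> t t' /eqP; rewrite nth_uniq ?enum_uniq // => /eqP e.
  by apply: enum_rank_inj; apply: val_inj.
by move=> t; have := mem_nth x0 (szP t); rewrite mem_enum.
Qed.

Definition all_zero (w : nat) : basis w := [ffun=> false].

Definition add_qubit (w : nat) (b : bool) (a : basis w) : basis w.+1 :=
  [ffun i => if unlift ord0 i is Some j then a j else b].

Lemma add_qubit0 w b (a : basis w) : add_qubit b a ord0 = b.
Proof. by rewrite ffunE unlift_none. Qed.

Lemma add_qubit_inj w b : injective (@add_qubit w b).
Proof.
move=> a a' /ffunP e; apply/ffunP => j.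
by have := e (lift ord0 j); rewrite !ffunE liftK.
Qed.

Lemma add_qubit_all_zero w : add_qubit false (all_zero w) = all_zero w.+1.
Proof.
by apply/ffunP => i; rewrite !ffunE; case: unliftP => [j|] _; rewrite ?ffunE.
Qed.

Section Embed.
Variables (R : realType) (w : nat) (T : finType) (phi : T -> basis w).
Hypothesis phi_inj : injective phi.

Definition ket (a : basis w) : 'cV[R]_#|{: basis w}| :=
  delta_mx (enum_rank a) 0.

Definition embed (c : T -> R) : 'cV[R]_#|{: basis w}| :=
  \sum_t c t *: ket (phi t).

Lemma ketE a b : ket a (enum_rank b) 0 = (a == b)%:R.
Proof. by rewrite mxE eqxx andbT (inj_eq enum_rank_inj) eq_sym. Qed.

Lemma dot_ket a : dot (ket a) (ket a) = 1.
Proof. by rewrite dot_delta ketE eqxx. Qed.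

Lemma embed_out c a : (forall t, phi t != a) -> embed c (enum_rank a) 0 = 0.
Proof.
move=> out; rewrite summxE big1 // => t _.
by rewrite mxE ketE (negPf (out t)) mulr0.
Qed.

Lemma embed_in c t : embed c (enum_rank (phi t)) 0 = c t.
Proof.
rewrite summxE (bigD1 t) //= mxE ketE eqxx mulr1 big1 ?addr0 // => s st.
by rewrite mxE ketE (inj_eq phi_inj) (negPf st) mulr0.
Qed.

Lemma dot_embed c d : dot (embed c) (embed d) = \sum_t c t * d t.
Proof.
rewrite {2}/embed; elim/big_rec2: _ => [|t y1 y2 _ <-].
  by apply: big1 => i _; rewrite mxE mulr0.
by rewrite dotDr dotZr dot_delta embed_in mulrC.
Qed.

End Embed.

(** * One round of exact amplitude amplification *)

Section OverlapProtocol.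
Variables (R : realType) (X Y : Type) (T : finType) (w : nat).
Variables (phi : T -> basis w.+1) (u : X -> T -> R) (v : Y -> T -> R).
Hypothesis phi_inj : injective phi.
Hypothesis phi0 : forall t, phi t ord0 = false.
Hypothesis phi_neq0 : forall t, phi t != all_zero w.+1.
Hypothesis u_unit : forall x, \sum_t u x t ^+ 2 = 1.
Hypothesis v_unit : forall y, \sum_t v y t ^+ 2 = 1.

(* Qubit 0 is the output.  No [phi t] is the initial state or sets the output
   qubit, so [psi x - e0] and [chi y - e1] have squared norm 2 and the
   reflections along them swap e0 with [psi x] and e1 with [chi y]. *)
Let psi x := embed phi (u x).
Let chi y := embed phi (v y).
Let e0 := ket R (all_zero w.+1).
Let e1 := ket R (add_qubit true (all_zero w)).
Let overlap x y := \sum_t u x t * v y t.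

Let dot_psi x : dot (psi x) (psi x) = 1.
Proof. by rewrite dot_embed //; under eq_bigr do rewrite -expr2. Qed.

Let dot_chi y : dot (chi y) (chi y) = 1.
Proof. by rewrite dot_embed //; under eq_bigr do rewrite -expr2. Qed.

Let dot_embed_e0 c : dot (embed phi c) e0 = 0.
Proof. by rewrite dot_delta embed_out. Qed.

Let dot_embed_e1 c : dot (embed phi c) e1 = 0.
Proof.
rewrite dot_delta embed_out // => t; apply/eqP => /ffunP/(_ ord0).
by rewrite phi0 add_qubit0.
Qed.

Definition overlap_steps : seq (step R X Y w.+1) :=
  AliceOp (fun x => toC (householder 1 (psi x - e0))) :: send_all R X Y w.+1 ++
  BobOp (fun y => toC (householder 2 (chi y))) :: send_all R X Y w.+1 ++
  AliceOp (fun x => toC (householder 2 (psi x))) :: send_all R X Y w.+1 ++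
  [:: BobOp (fun y => toC (householder 1 (chi y - e1)))].

(** Each [send_all] complements Alice's holdings, which start full, so the acting party always holds
    every qubit and locality is automatic. *)
Lemma overlap_steps_wf : well_formed [set: 'I_w.+1]%SET overlap_steps.
Proof.
have dot_diff (a b : 'cV[R]_#|{: basis w.+1}|) : dot a a = 1 -> dot b b = 1 ->
    dot a b = 0 -> 1 * dot (a - b) (a - b) = 2.
  by move=> aa bb ab; rewrite dotBl !dotBr aa bb (dotC b) ab; ring.
have ok k (r : 'cV[R]_#|{: basis w.+1}|) : k * dot r r = 2 ->
    toC (householder k r) \is unitarymx /\
    acts_on [set: 'I_w.+1]%SET (toC (householder k r)).
  split; last exact: acts_on_setT.
  by apply: unitary_toC; exact: householder_orthogonal.
split=> [x|].
  apply: ok; apply: dot_diff; [exact: dot_psi|exact: dot_ket|].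
  exact: dot_embed_e0.
apply/well_formed_send_all; rewrite finset.setCT.
split=> [y|]; first by rewrite finset.setC0; apply: ok; rewrite dot_chi mulr1.
apply/well_formed_send_all; rewrite finset.setC0.
split; first by move=> x; apply: ok; rewrite dot_psi mulr1.
apply/well_formed_send_all; rewrite finset.setCT.
split=> // y; rewrite finset.setC0; apply: ok.
by apply: dot_diff; [exact: dot_chi|exact: dot_ket|exact: dot_embed_e1].
Qed.

Definition overlap_protocol : protocol R X Y :=
  @Protocol R X Y w.+1 [set: 'I_w.+1]%SET overlap_steps ord0 overlap_steps_wf.

Lemma cost_overlap_protocol : cost overlap_protocol = (3 * w.+1)%N.
Proof.
rewrite /cost /=; do 3 rewrite count_cat count_send_all /=.
lia.
Qed.

(** Before Bob's last step the state is (4A^2 - 1) psi - 2A chi. Its inner product with chi - e1 is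
    A(4A^2 - 3), and the last reflection subtracts that multiple of chi - e1. *)
Lemma final_overlap_protocol x y :
  let A := overlap x y in
  final_state overlap_protocol x y =
    toC ((4 * A ^+ 2 - 1) *: psi x + (A * (1 - 4 * A ^+ 2)) *: chi y
         + (A * (4 * A ^+ 2 - 3)) *: e1).
Proof.
move=> A; have dAl : dot (psi x) (chi y) = A by rewrite dot_embed.
have dAr : dot (chi y) (psi x) = A by rewrite dotC.
rewrite /final_state /=; do 3 rewrite foldl_cat foldl_send_all /=.
have -> : zero_state R w.+1 = toC e0 by rewrite /toC map_delta_mx.
rewrite /toC -!map_mxM; congr map_mx.
rewrite !householder_mul.
have de0 c : dot e0 (embed phi c) = 0 by rewrite dotC.
have de1 c : dot e1 (embed phi c) = 0 by rewrite dotC.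
rewrite !(dotBl, dotBr, dotZr) !(dot_psi, dot_chi, dAl, dAr, dot_ket).
rewrite !(dot_embed_e0, dot_embed_e1, de0, de1).
apply/matrixP => i j; rewrite !mxE; ring.
Qed.

Lemma overlap_protocol_false x y : overlap x y = 0 ->
  prob_output overlap_protocol x y false = 1.
Proof.
move=> A0; rewrite /prob_output final_overlap_protocol A0 /=.
(* The state is now [- psi x], which vanishes wherever the output qubit is set, so the restricted
   sum is the full squared norm. *)
transitivity (real_complex R (dot (psi x) (psi x))); last by rewrite dot_psi.
rewrite /dot (reindex (@enum_rank _)) /=; last first.
  by exists (@enum_val _ _) => a _; rewrite ?enum_rankK ?enum_valK.
rewrite rmorph_sum big_mkcond; apply: eq_bigr => a _ /=.
case: ifP => [_|/negbT a0].
  rewrite mxE normC_real_complex !mxE; congr (_%:C)%C; ring.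
rewrite embed_out ?mul0r // => t; apply: contra_neq a0 => <-.
by rewrite phi0.
Qed.

Lemma overlap_protocol_true x y : overlap x y ^+ 2 = 4^-1 ->
  prob_output overlap_protocol x y true = 1.
Proof.
move=> A4; rewrite /prob_output final_overlap_protocol A4 /=.
have -> : (4 * 4^-1 : R) = 1 by field.
rewrite subrr mulr0 !scale0r !add0r.
(* Only [e1] survives, with coefficient A(4A^2 - 3) = -2A, whose square is 1. *)
rewrite (bigD1 (add_qubit true (all_zero w))) ?add_qubit0 //= big1 => [|a].
  rewrite addr0 mxE normC_real_complex mxE ketE eqxx mulr1 exprMn A4.
  by rewrite -[RHS](rmorph1 (real_complex R)); congr (_%:C)%C; field.
case/andP=> _ ne; rewrite mxE normC_real_complex mxE ketE eq_sym (negPf ne).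
by rewrite mulr0 expr0n.
Qed.

End OverlapProtocol.

(** The strict bound on [#|T|] reserves the all-zero string for the initial state; the extra qubit
    in [w.+1] carries the output. *)
Lemma exists_overlap_protocol (R : realType) (X Y : Type) (T : finType)
    (w : nat) (u : X -> T -> R) (v : Y -> T -> R) :
  (#|T| < 2 ^ w)%N ->
  (forall x, \sum_t u x t ^+ 2 = 1) -> (forall y, \sum_t v y t ^+ 2 = 1) ->
  exists P : protocol R X Y, [/\ cost P = (3 * w.+1)%N,
    forall x y, \sum_t u x t * v y t = 0 -> prob_output P x y false = 1 &
    forall x y, (\sum_t u x t * v y t) ^+ 2 = 4^-1 ->
      prob_output P x y true = 1].
Proof.
move=> Tw uu vv.
have [|f finj fP] :=
    @injection_into T (basis w) (predC1 (all_zero w)) (all_zero w).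
  by rewrite cardC1 card_ffun card_bool card_ord -ltnS prednK ?expn_gt0.
have phi_inj : injective (add_qubit false \o f).
  by apply: inj_comp => //; exact: add_qubit_inj.
have phi0 t : (add_qubit false \o f) t ord0 = false by rewrite /= add_qubit0.
have phi_neq0 t : (add_qubit false \o f) t != all_zero w.+1.
  by rewrite /= -add_qubit_all_zero (inj_eq (@add_qubit_inj _ _)); exact: fP.
exists (overlap_protocol phi_inj phi0 phi_neq0 uu vv); split.
- exact: cost_overlap_protocol.
- exact: overlap_protocol_false.
- exact: overlap_protocol_true.
Qed.

(** * Vectors whose overlap depends on the Hamming distance *)

Section HammingOverlap.
Variables (R : realType) (n : nat).
Implicit Types x y : n.-tuple bool.

Definition parity x : bool := \big[addb/false]_i tnth x i.

Lemma HammingE x y : Hamming x y = (\sum_i (tnth x i (+) tnth y i))%N.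
Proof.
rewrite /Hamming -sum1_card big_mkcond; apply: eq_bigr => i _.
by rewrite inE -negb_eqb; case: (_ == _).
Qed.

(** The parity of the distance splits into one bit per party, so block choice and weights can depend
    on it without communication. *)
Lemma parity_addb x y : parity x (+) parity y = odd (Hamming x y).
Proof.
rewrite /parity -big_split HammingE (big_morph odd oddD (erefl _)) /=.
by apply: eq_bigr => i _; rewrite oddb.
Qed.

Lemma sum_sign x y :
  \sum_i (-1) ^+ tnth x i * (-1) ^+ tnth y i = n%:R - 2 * (Hamming x y)%:R :> R.
Proof.
rewrite HammingE natr_sum mulr_sumr -[n in n%:R]card_ord -sum1_card natr_sum.
rewrite -sumrB; apply: eq_bigr => i _.
by case: (tnth x i); case: (tnth y i) => /=; ring.
Qed.

(** The boolean names the block; the [unit] point is Bob's normalising coordinate. *)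
Local Notation index := (unit + 'I_n * bool)%type.

Lemma sum_index (F : index -> R) :
  \sum_t F t = F (inl tt) + \sum_i (F (inr (i, true)) + F (inr (i, false))).
Proof.
rewrite big_sumType /= (big_pred1 tt) => [|[]//]; congr (_ + _).
under [RHS]eq_bigr => i _ do rewrite -(big_bool _ (fun b => F (inr (i, b)))).
by rewrite pair_bigA; apply: eq_bigr => -[].
Qed.

(* [n - 2 * d] over [n] is +-1 for even [d] in {0, 1, n-1, n} and
   +-(1 - 2/n) for odd [d]: these weights turn both into +-1/2. *)
Definition weight (b : bool) : R := if b then n%:R / (2 * (n%:R - 2)) else 2^-1.
Arguments weight : simpl never.

Definition alice_vec x (t : index) : R :=
  if t is inr (i, b) then
    (b == parity x)%:R * (-1) ^+ tnth x i / Num.sqrt n%:R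
  else 0.

Definition bob_vec y (t : index) : R :=
  if t is inr (i, b) then
    weight (b (+) parity y) * (-1) ^+ tnth y i / Num.sqrt n%:R
  else Num.sqrt (1 - weight true ^+ 2 - weight false ^+ 2).

Hypothesis n_ge6 : (6 <= n)%N.

Let n_ge6R : 6 <= n%:R :> R.
Proof. by rewrite (ler_nat R 6). Qed.

Let sqr_sqrt_n : Num.sqrt (n%:R : R) ^+ 2 = n%:R.
Proof. by rewrite sqr_sqrtr // ler0n. Qed.

Let sum_over_n (k : R) : \sum_(i < n) k / n%:R = k.
Proof.
by rewrite sumr_const card_ord -[LHS]mulr_natr mulfVK //
  pnatr_eq0 -lt0n (leq_trans _ n_ge6).
Qed.

Let sqr_entry (k : R) (b : bool) :
  (k * (-1) ^+ b / Num.sqrt n%:R) ^+ 2 = k ^+ 2 / n%:R.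
Proof. by rewrite expr_div_n sqr_sqrt_n exprMn sqrr_sign mulr1. Qed.

Lemma alice_vec_unit x : \sum_t alice_vec x t ^+ 2 = 1.
Proof.
rewrite sum_index /= expr0n add0r -[RHS](sum_over_n 1); apply: eq_bigr => i _.
rewrite !sqr_entry.
by case: (parity x) => /=; ring.
Qed.

(** For [n >= 6], n / (2(n - 2)) is at most 3/4, and 9/16 + 1/4 < 1. At n = 4 that weight would be
    1, leaving no room for the 1/4. *)
Lemma weight_sum : weight true ^+ 2 + weight false ^+ 2 <= 1.
Proof.
have n2 : 0 < n%:R - 2 :> R by have := n_ge6R; lra.
have : weight true <= 3 / 4.
  by rewrite /weight ler_pdivrMr ?mulr_gt0 //; have := n_ge6R; lra.
have : 0 <= weight true by rewrite /weight divr_ge0 // mulr_ge0 // ltW.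
by rewrite {4}/weight; nra.
Qed.

Lemma bob_vec_unit y : \sum_t bob_vec y t ^+ 2 = 1.
Proof.
rewrite sum_index /= sqr_sqrtr; last first.
  by rewrite -addrA -opprD subr_ge0 weight_sum.
rewrite (eq_bigr (fun=> (weight true ^+ 2 + weight false ^+ 2) / n%:R)).
  by rewrite sum_over_n; ring.
move=> i _; rewrite !sqr_entry.
by case: (parity y) => /=; ring.
Qed.

(** Only the block [parity x] contributes; Bob's weight there is indexed by [parity x (+) parity y],
    and the signs add up by [sum_sign]. *)
Lemma overlapE x y : \sum_t alice_vec x t * bob_vec y t =
  weight (odd (Hamming x y)) * (n%:R - 2 * (Hamming x y)%:R) / n%:R.
Proof.
rewrite sum_index /= mul0r add0r -parity_addb -sum_sign mulr_sumr mulr_suml.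
have -> : n%:R^-1 = (Num.sqrt n%:R)^-1 ^+ 2 :> R by rewrite exprVn sqr_sqrt_n.
by apply: eq_bigr => i _; case: (parity x) => /=; ring.
Qed.

Lemma overlap_half x y : ~~ odd n -> Hamming x y = (n %/ 2)%N ->
  \sum_t alice_vec x t * bob_vec y t = 0.
Proof.
move=> even_n half; rewrite overlapE half.
have -> : n%:R = 2 * (n %/ 2)%:R :> R.
  by rewrite -natrM mulnC divnK // dvdn2.
by rewrite subrr mulr0 mul0r.
Qed.

Lemma overlap_near x y : ~~ odd n -> Hamming x y \in [:: 0; 1; n - 1; n]%N ->
  (\sum_t alice_vec x t * bob_vec y t) ^+ 2 = 4^-1.
Proof.
move=> even_n; rewrite overlapE.
have n0 : n%:R != 0 :> R by rewrite gt_eqF //; have := n_ge6R; lra.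
have n2 : n%:R - 2 != 0 :> R by rewrite gt_eqF //; have := n_ge6R; lra.
rewrite !inE => /or4P[] /eqP->.
- by rewrite /weight /=; field.
- by rewrite /weight /=; field; rewrite n0.
(* As [n] is even, [n - 1] is odd and gets the same weight as distance 1. *)
- rewrite natrB ?(leq_trans _ n_ge6) // oddB ?(leq_trans _ n_ge6) //.
  by rewrite (negPf even_n) /weight /=; field; rewrite n0.
- by rewrite (negPf even_n) /weight /=; field.
Qed.

End HammingOverlap.

(** * The logarithmic cost bound *)

Theorem theorem1 (R : realType) :
  exists C : R, \forall n \near \oo, ~~ odd n ->
    (Q_E R (@EQ' n) <= (C * ln (n%:R : R))%:E)%E.
Proof.
(* With t the integer part of log2 n, t + 3 qubits hold the 2n + 1 coordinates. The cost 3(t + 4) is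
   at most 15t since t >= 1, and t ln 2 <= ln n. *)
exists (15 / ln 2); exists 6%N => // n /= n_ge6 even_n.
set t := trunc_log 2 n.
have t_gt0 : (0 < t)%N by rewrite trunc_log_gt0; lia.
have tn : (2 ^ t <= n)%N by apply: trunc_logP; lia.
have nt : (n < 2 ^ t.+1)%N by exact: trunc_log_ltn.
have cardT : (#|{: unit + 'I_n * bool}| < 2 ^ t.+3)%N.
  rewrite card_sum card_unit card_prod card_ord card_bool.
  by move: nt; rewrite !expnS; lia.
have [P [costP P0 P1]] := exists_overlap_protocol cardT
  (alice_vec_unit R n_ge6) (bob_vec_unit R n_ge6).
have PE : computes_exactly P (@EQ' n).
  move=> x y b; rewrite /EQ'; case: ifP => [near [<-]|_].
    by apply: P1; exact: overlap_near.
  case: ifP => // /eqP half [<-]; apply: P0; exact: overlap_half.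
apply: (@le_trans _ _ ((cost P)%:R)%:E).
  by apply: ereal_inf_lbound; exists P.
have ln2 : 0 < ln 2 :> R by rewrite ln_gt0 // ltr1n.
have tln : t%:R * ln 2 <= ln n%:R :> R.
  rewrite mulr_natl -lnXn // ler_ln ?posrE ?exprn_gt0 // ?ltr0n; last by lia.
  by rewrite -natrX ler_nat.
rewrite lee_fin costP.
apply: (@le_trans _ _ (15 * t%:R)); first by rewrite -natrM ler_nat; lia.
by rewrite -mulrA ler_pM2l // mulrC ler_pdivlMr.
Qed.
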